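(* Let $M$ be a weakly stationary random measure on $\mathbb{R}^d$ whose spectral measure $S$ is purely atomic. Then $M$ is perfectly interpolable from any cone of $\mathbb{R}^d$ with non-empty interior.
   Context: For $B\subset\mathbb{R}^d$, $\mathcal{C}_c^b(B)$ is the class of bounded measurable functions on $\mathbb{R}^d$ with bounded support, supported in $B$. A weakly stationary random measure $M$ on $\mathbb{R}^d$ is a collection of complex square integrable random variables $M(f)$, $f\in\mathcal{C}_c^b(\mathbb{R}^d)$, on a probability space $(\Omega,\mathbf{P})$ such that (i) $M$ a.s. induces a complex-valued measure on each compact set, and (ii) $\mathrm{Var}(M(\tau_x f))=\mathrm{Var}(M(f))$ for every translation $\tau_x$, $x\in\mathbb{R}^d$. Its spectral measure $S$ is the non-negative symmetric measure on $\mathbb{R}^d$ such that $\mathrm{Var}(M(f))=(2\pi)^{-d}\int_{\mathbb{R}^d}|\hat f|^2\,dS$ for all $f\in\mathcal{C}_c^b(\mathbb{R}^d)$, where $\hat f(u)=\int_{\mathbb{R}^d}e^{-iu\cdot x}f(x)\,dx$; it satisfies $\int(1+\|u\|)^{-d-1}S(du)<\infty$. $M$ is perfectly interpolable from $A\subset\mathbb{R}^d$ if for every $f\in\mathcal{C}_c^b(A^c)$ there are $h_n\in\mathcal{C}_c^b(A)$, $n\ge1$, such that $M(h_n)\to M(f)$ in $L^2(\mathbf{P})$.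
   Formalization: Since variance conditions leave the mean of M free (M(f)=f(0) is a counterexample), perfect interpolability is proved for M minus its mean, and for M itself when the mean is also translation invariant. *)

(* Defs.v *)
From HB Require Import structures.
From mathcomp Require Import all_boot all_order all_algebra.
From mathcomp Require Import complex.
From mathcomp Require Import all_classical all_reals all_analysis.

Set Implicit Arguments.
Unset Strict Implicit.
Unset Printing Implicit Defensive.

Import Order.TTheory GRing.Theory Num.Theory.
Import numFieldNormedType.Exports.
Import ComplexField.Normc.

Local Open Scope classical_set_scope.
Local Open Scope ring_scope.
Local Open Scope complex_scope.

(* The product sigma-algebra on row vectors, as the library has it on tuples;
   by [measurable_coord] and [open_measurable_rV] it is the Borel one. *)
Section measurable_rV.
Context {R : realType} (n : nat).

Let coors : 'I_n -> 'rV[R]_n -> R := fun i x => x ord0 i.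

Let rV_set0 : g_sigma_preimage coors set0.
Proof. exact: sigma_algebra0. Qed.

Let rV_setC A : g_sigma_preimage coors A -> g_sigma_preimage coors (~` A).
Proof. exact: sigma_algebraC. Qed.

Let rV_bigcup (F : _^nat) : (forall i, g_sigma_preimage coors (F i)) ->
  g_sigma_preimage coors (\bigcup_i (F i)).
Proof. exact: sigma_algebra_bigcup. Qed.

HB.instance Definition _ := @isMeasurable.Build default_measure_display
  'rV[R]_n (g_sigma_preimage coors) rV_set0 rV_setC rV_bigcup.

End measurable_rV.

Lemma measurable_coord (R : realType) n (i : 'I_n) :
  measurable_fun [set: 'rV[R]_n] (fun x => x ord0 i).
Proof.
move=> _ Y mY; rewrite setTI; apply: sub_sigma_algebra => /=.
rewrite -bigcup_seq/=; exists i => /=; first by rewrite mem_index_enum.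
by exists Y => //; rewrite setTI.
Qed.

Lemma measurable_fun_rV d (T : measurableType d) (R : realType) n
    (f : T -> 'rV[R]_n) :
  (forall i, measurable_fun [set: T] (fun t => f t ord0 i)) ->
  measurable_fun [set: T] f.
Proof.
move=> mf _ Y mY; rewrite setTI.
suff: <<s \big[setU/set0]_(i < n) preimage_set_system [set: 'rV[R]_n]
   (fun x => x ord0 i) measurable >> `<=` [set A | measurable (f @^-1` A)].
  by apply.
apply: smallest_sub.
  split => /=; first by rewrite preimage_set0.
  - by move=> A mA; rewrite setTD preimage_setC; exact: measurableC.
  - by move=> F mF; rewrite preimage_bigcup; exact: bigcup_measurable.
rewrite -bigcup_seq => A [i _ [B mB <-]] /=.
by rewrite setTI -comp_preimage -[X in measurable X]setTI; exact: mf.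
Qed.

Lemma measurable_box (R : realType) n (B : 'I_n -> set R) :
  (forall i, measurable (B i)) ->
  measurable [set x : 'rV[R]_n | forall i, B i (x ord0 i)].
Proof.
move=> mB; rewrite (_ : [set x | _] =
    \bigcap_(i in [set: 'I_n]) ((fun x : 'rV[R]_n => x ord0 i) @^-1` B i)).
  apply: fin_bigcap_measurable => [|i _]; first exact: finite_finset.
  by rewrite -[X in measurable X]setTI; exact: measurable_coord.
by apply/seteqP; split => x /= Bx i; [move=> _|]; exact: Bx.
Qed.

Lemma open_measurable_rV (R : realType) n (U : set 'rV[R]_n) :
  open U -> measurable U.
Proof.
move=> oU.
pose b (p : 'rV[rat]_n * nat) : set 'rV[R]_n :=
  [set x | forall i, ball (ratr (p.1 ord0 i) : R) p.2.+1%:R^-1 (x ord0 i)].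
rewrite (_ : U = \bigcup_p (if `[< b p `<=` U >] then b p else set0)); last first.
  apply/seteqP; split => [x Ux|x [p _]]; last by case: asboolP => // + bx; apply.
  have /nbhs_ballP[e /= e0 eU] : nbhs x U by exact: open_nbhs_nbhs.
  have [k ke] : exists k : nat, k.+1%:R^-1 < e / 2.
    exists (Num.trunc (e / 2)^-1).
    by rewrite invf_plt ?posrE ?divr_gt0// truncnS_gt.
  have /choice[q qx] : forall i, exists q : rat,
      ratr q \in `](x ord0 i - k.+1%:R^-1), (x ord0 i + k.+1%:R^-1)[.
    by move=> i; apply: rat_in_itvoo; rewrite ltrD2l gtrN// invr_gt0.
  have bx : b (\row_i q i, k) x.
    move=> i /=; rewrite mxE; apply: ball_sym.
    by rewrite ball_itv /= qx.
  exists (\row_i q i, k) => //; case: asboolP => // -[] y yb.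
  apply: eU; split => // i j; rewrite (ord1 i) (splitr e).
  apply: (@ball_triangle R R (ratr (q j) : R)).
    have /= := bx j; rewrite mxE => /ball_sym; apply: le_ball; exact: ltW.
  by have /= := yb j; rewrite mxE; apply: le_ball; exact: ltW.
apply: countable_bigcupT_measurable => [|p]; first exact: countableP.
case: asboolP => // _.
exact: (measurable_box (fun i => measurable_realfun.measurable_ball (ratr (p.1 ord0 i)) _)).
Qed.

Section lebesgue_rV.
Context {R : realType}.

Definition rV_cons n (p : 'rV[R]_n * R) : 'rV[R]_n.+1 :=
  row_mx (p.2%:M : 'rV_1) p.1.

Lemma measurable_rV_cons n : measurable_fun [set: 'rV[R]_n * R] (@rV_cons n).
Proof.
apply: measurable_fun_rV => i; rewrite /rV_cons.
case: (split_ordP (m := 1) i) => j ->.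
- rewrite (_ : (fun _ => _) = snd) //.
  apply/funext => p; apply: etrans (row_mxEl _ _ _ _) _.
  by rewrite mxE (ord1 j).
- rewrite (_ : (fun _ => _) = (fun x : 'rV[R]_n => x ord0 j) \o fst).
    by apply: measurableT_comp; [exact: measurable_coord|].
  by apply/funext => p; exact: row_mxEr.
Qed.

Definition lebesgue_rV_succ n (mu : {measure set 'rV[R]_n -> \bar R}) :=
  pushforward (mu \x @lebesgue_measure R)%E (@rV_cons n).

HB.instance Definition _ n (mu : {measure set 'rV[R]_n -> \bar R}) :=
  Measure.copy (lebesgue_rV_succ mu)
    (measure_function_pushforward__canonical__measure_function_Measure
       (mu \x @lebesgue_measure R)%E (@measurable_rV_cons n)).

Fixpoint lebesgue_rV n : {measure set 'rV[R]_n -> \bar R} :=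
  if n is n'.+1 then lebesgue_rV_succ (lebesgue_rV n') else dirac (0 : 'rV[R]_0).

End lebesgue_rV.

Lemma lebesgue_rV_box (R : realType) n (B : 'I_n -> set R) :
  (forall i, measurable (B i)) ->
  lebesgue_rV n [set x | forall i, B i (x ord0 i)] =
  (\prod_(i < n) lebesgue_measure (B i))%E.
Proof.
elim: n => [|n IHn] in B *; move=> mB /=.
  by rewrite big_ord0 /dirac indicE mem_set// => -[].
rewrite big_ord_recl /lebesgue_rV_succ /pushforward.
rewrite (_ : _ @^-1` _ = [set x : 'rV[R]_n | forall i, B (lift ord0 i) (x ord0 i)]
  `*` B ord0); last first.
  have e0 (p : 'rV[R]_n * R) : rV_cons p ord0 ord0 = p.2.
    rewrite (_ : ord0 = lshift n (ord0 : 'I_1)) /rV_cons; last exact/val_inj.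
    by apply: etrans (row_mxEl _ _ _ _) _; rewrite mxE.
  have e1 (p : 'rV[R]_n * R) i : rV_cons p ord0 (lift ord0 i) = p.1 ord0 i.
    rewrite (_ : lift ord0 i = rshift 1 i) /rV_cons; last exact/val_inj.
    exact: row_mxEr.
  apply/seteqP; split => p /= => [Bp|[Bp1 Bp2] i].
    split; last by rewrite -e0; exact: Bp.
    by move=> i; rewrite -e1; exact: Bp.
  by case: (unliftP ord0 i) => [j|] ->; rewrite ?e0 ?e1.
have mB' i : measurable (B (lift ord0 i)) by [].
have mbox := measurable_box mB'.
rewrite product_measure1E; [|exact: mbox|exact: (mB ord0)].
by rewrite (IHn (fun i => B (lift ord0 i)))// muleC.
Qed.

Section complex_valued.
Context {d} {T : measurableType d} {R : realType}.

Definition cmeasurable_fun (f : T -> R[i]) :=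
  measurable_fun [set: T] (@complex.Re R \o f) /\ measurable_fun [set: T] (@complex.Im R \o f).

Definition cintegral (mu : {measure set T -> \bar R}) (f : T -> R[i]) : R[i] :=
  Rintegral mu setT (@complex.Re R \o f) +i* Rintegral mu setT (@complex.Im R \o f).

Definition L2norm2 (mu : {measure set T -> \bar R}) (f : T -> R[i]) : \bar R :=
  (\int[mu]_x (normc (f x) ^+ 2)%:E)%E.

Definition csquare_integrable (mu : {measure set T -> \bar R}) (f : T -> R[i]) :=
  cmeasurable_fun f /\ (L2norm2 mu f < +oo)%E.

Definition cvariance (P : {measure set T -> \bar R}) (X : T -> R[i]) : \bar R :=
  L2norm2 P (fun w => X w - cintegral P X).

(* Independent of the Hahn decomposition that [cid] picks. *)
Definition charge_integral (nu : {charge set T -> \bar R}) (f : T -> R[i])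
    : R[i] :=
  let: exist P ex_N := cid (Hahn_decomposition nu) in
  let: exist N nuPN := cid ex_N in
  cintegral (jordan_pos nuPN) f - cintegral (jordan_neg nuPN) f.

End complex_valued.

Section random_measures.
Context {R : realType} {d : nat}.
Local Notation V := 'rV[R]_d.

Definition dotp (u x : V) : R := \sum_(i < d) u ord0 i * x ord0 i.

(* The library norm on ['rV_d] is the sup norm. *)
Definition enorm (u : V) : R := Num.sqrt (dotp u u).

Definition fourier (f : V -> R[i]) (u : V) : R[i] :=
  cintegral (lebesgue_rV d)
    (fun x => (cos (dotp u x) -i* sin (dotp u x)) * f x).

Definition translate (x : V) (f : V -> R[i]) : V -> R[i] :=
  fun y => f (y - x).

Definition Ccb (B : set V) : set (V -> R[i]) :=
  [set f : V -> R[i] |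
    [/\ cmeasurable_fun f,
        exists C : R, forall x, normc (f x) <= C,
        bounded_set [set x : V | f x != 0]
      & forall x, ~ B x -> f x = 0]].

Context {dO : measure_display} {Omega : measurableType dO}.
Context (P : probability Omega R).
Implicit Type M : (V -> R[i]) -> Omega -> R[i].

(* The induced complex measure on [K] is [nr + i ni]; only the values of the
   two charges on measurable subsets of [K] matter. *)
Definition induces_complex_measures (m : (V -> R[i]) -> R[i]) :=
  forall K : set V, compact K ->
    exists nr ni : {charge set V -> \bar R}, forall f, Ccb K f ->
      m f = charge_integral nr f + (0 +i* 1) * charge_integral ni f.

Definition weakly_stationary_random_measure M :=
  [/\ forall f, Ccb setT f -> csquare_integrable P (M f),
      {ae P, forall w, induces_complex_measures (fun f => M f w)}
    & forall f x, Ccb setT f ->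
        cvariance P (M (translate x f)) = cvariance P (M f)].

(* The variance conditions do not constrain the mean of [M] at all: the
   deterministic [M f = f 0] satisfies them with spectral measure [0], and it is
   not perfectly interpolable from a set that misses the origin. Convergence in
   [L^2] thus has to be read for the centered field, unless the mean is
   translation invariant too. *)
Definition stationary_mean M := forall f x, Ccb setT f ->
  cintegral P (M (translate x f)) = cintegral P (M f).

Definition centered M : (V -> R[i]) -> Omega -> R[i] :=
  fun f w => M f w - cintegral P (M f).

Definition is_spectral_measure M (S : {measure set V -> \bar R}) :=
  [/\ forall A : set V, measurable A -> S (-%R @^-1` A) = S A,
      forall f, Ccb setT f ->
        cvariance P (M f) =
          (((2 * pi) ^- d)%:E * L2norm2 S (fourier f))%E
    & (\int[S]_u ((1 + enorm u) ^- d.+1)%:E < +oo)%E].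

Definition perfectly_interpolable M (A : set V) :=
  forall f, Ccb (~` A) f ->
    exists2 h : (V -> R[i])^nat, forall n, Ccb A (h n) &
      L2norm2 P (fun w => M (h n) w - M f w) @[n --> \oo] --> 0%E.

Definition purely_atomic (S : {measure set V -> \bar R}) :=
  exists (a : nat -> {nonneg R}) (u : nat -> V), forall A, measurable A ->
    S A = mseries (fun k => mscale (a k) (dirac (u k))) 0 A.

Definition is_cone (A : set V) :=
  forall x (t : R), A x -> 0 < t -> A (t *: x).

End random_measures.

(* Main.v *)
(* Approximate M(f) by M(tau_x f) with x = n v, where v is interior to the cone.
   For n large, the bounded support of tau_x f lies in the cone. As
   hat(tau_x f)(u) = e^{-i u.x} hat f(u), the variance of M(tau_x f) - M(f) is
   proportional to the sum over the atoms u_k, with masses a_k, of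
   a_k |e^{-i n u_k.v} - 1|^2 |hat f(u_k)|^2. The tail of this sum is small
   uniformly in n, and by simultaneous recurrence of the rotations of angles
   u_k.v, arbitrarily large n make the finitely many remaining terms small. *)
Require Import Defs.
From mathcomp Require Import all_boot all_order all_algebra.
From mathcomp Require Import complex.
From mathcomp Require Import all_classical all_reals all_analysis.
From mathcomp Require Import measurable_realfun.
From mathcomp Require Import ring lra.

Set Implicit Arguments.
Unset Strict Implicit.
Unset Printing Implicit Defensive.

Import Order.TTheory GRing.Theory Num.Theory.
Import numFieldNormedType.Exports.
Import ComplexField.Normc.

Local Open Scope classical_set_scope.
Local Open Scope ring_scope.
Local Open Scope complex_scope.

(** * Translation invariance of Lebesgue measure on row vectors *)

Lemma measurable_shift_rV (R : realType) n (x : 'rV[R]_n) :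
  measurable_fun [set: 'rV[R]_n] (fun y => y - x).
Proof.
apply: measurable_fun_rV => i; under eq_fun do rewrite !mxE.
by apply: measurable_funB; [exact: measurable_coord|exact: measurable_cst].
Qed.

(** Lebesgue measure is determined by its values on half-open intervals, and its pushforward [nu]
    under the shift has the same values there. *)
Lemma lebesgue_measure_shift (R : realType) (a : R) (A : set R) :
  measurable A ->
  lebesgue_measure ((fun t => t - a) @^-1` A) = lebesgue_measure A.
Proof.
move=> mA; have ms : measurable_fun [set: measurableTypeR R]
    (fun t : measurableTypeR R => (t - a : measurableTypeR R)).
  by apply: measurable_funB; [exact: measurable_id|exact: measurable_cst].
pose nu := [the {measure set (measurableTypeR R) -> \bar R} of
  measure_function_pushforward__canonical__measure_function_Measure
    (@lebesgue_measure R) ms].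
apply/esym; apply: (@lebesgue_measure_unique _ nu) => // _ [[b c]] _ <-.
rewrite /nu /= /pushforward.
have -> : (fun t => t - a) @^-1` `]b, c] = `](b + a), (c + a)]%classic.
  apply/seteqP; split => t /=; rewrite !in_itv /=.
    by move=> /andP[bt tc]; apply/andP; split; lra.
  by move=> /andP[bt tc]; apply/andP; split; lra.
rewrite !lebesgue_measure_itv /= !lte_fin ltrD2r.
by case: ifP => // _; rewrite -!EFinD; congr (_%:E); ring.
Qed.

Lemma rV_cons_lshift (R : realType) n (p : 'rV[R]_n * R) (j : 'I_1) :
  rV_cons p ord0 (lshift n j) = p.2.
Proof. by apply: etrans (row_mxEl _ _ _ _) _; rewrite mxE (ord1 j). Qed.

Lemma rV_cons_rshift (R : realType) n (p : 'rV[R]_n * R) (j : 'I_n) :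
  rV_cons p ord0 (rshift 1 j) = p.1 ord0 j.
Proof. exact: row_mxEr. Qed.

Lemma rV_consB (R : realType) n (p : 'rV[R]_n * R) (x : 'rV[R]_n.+1) :
  rV_cons p - x = rV_cons (p.1 - rsubmx (x : 'rV_(1 + n)), p.2 - x ord0 ord0).
Proof.
apply/rowP => i; rewrite [LHS]mxE [X in _ + X]mxE.
case: (split_ordP (m := 1) i) => j ->.
  rewrite !rV_cons_lshift (ord1 j) /=; congr (_ - x _ _); exact/val_inj.
by rewrite !rV_cons_rshift !mxE.
Qed.

(** Induction on the dimension, slicing along the first coordinate: shifting that coordinate keeps
    the length of every slice, and shifting the others is a change of variables covered by the
    induction hypothesis. *)
Lemma lebesgue_rV_shift (R : realType) n (x : 'rV[R]_n) (A : set 'rV[R]_n) :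
  measurable A -> lebesgue_rV n ((fun y => y - x) @^-1` A) = lebesgue_rV n A.
Proof.
elim: n => [|n IHn] in x A *; move=> mA.
  by congr (lebesgue_rV 0 _); apply/seteqP; split => y /=;
    rewrite (thinmx0 (y - x)) (thinmx0 y).
set C := @rV_cons R n @^-1` A.
have mC : measurable C.
  by rewrite -[C]setTI; exact: measurable_rV_cons.
pose phi := @lebesgue_measure R \o xsection C.
set x' := rsubmx (x : 'rV_(1 + n)).
have mphi : measurable_fun setT phi.
  exact: (measurable_fun_xsection (@lebesgue_measure R) mC).
pose s (y : 'rV[R]_n) := y - x'.
have ms : measurable_fun setT s := measurable_shift_rV x'.
(* Both sides unfold, by definition of the product measure, to integrals of the lengths of
   slices. *)
transitivity (\int[lebesgue_rV n]_y (phi \o s) y)%E.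
  apply: eq_integral => y _ /=.
  rewrite -[RHS](lebesgue_measure_shift (x ord0 ord0)); last first.
    exact: measurable_xsection.
  congr lebesgue_measure; apply/seteqP; split => t /=.
    by rewrite /xsection /= !inE /C /= rV_consB.
  by rewrite /xsection /= !inE /C /= rV_consB.
rewrite -[[set: 'rV[R]_n]](preimage_setT s).
rewrite -ge0_integral_pushforward//.
by apply: eq_measure_integral => B mB _; exact: IHn.
Qed.

(** * Integration against a purely atomic measure *)

Import HBNNSimple.

(* No measurability of [g] is needed, as the integral is a supremum over simple
   functions; this spares a proof that Fourier transforms are measurable. *)
Lemma integral_atomic d (T : measurableType d) (R : realType)
    (mu : {measure set T -> \bar R}) (a : nat -> {nonneg R}) (u : nat -> T)
    (g : T -> \bar R) :
  (forall x : T, measurable [set x]) ->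
  (forall A, measurable A ->
    mu A = mseries (fun k => mscale (a k) (dirac (u k))) 0 A) ->
  (forall x, 0 <= g x)%E ->
  (\int[mu]_x g x = \sum_(k <oo) (a k)%:num%:E * g (u k))%E.
Proof.
move=> m1 muE g0.
have measurable_case f : measurable_fun [set: T] f -> (forall x, 0 <= f x)%E ->
    (\int[mu]_x f x = \sum_(k <oo) (a k)%:num%:E * f (u k))%E.
  move=> mf f0.
  rewrite (eq_measure_integral (mseries (fun k => mscale (a k) (dirac (u k))) 0));
    last by move=> A mA _; exact: muE.
  rewrite ge0_integral_measure_series//; apply: eq_eseriesr => k _.
  by rewrite ge0_integral_mscale// integral_dirac// diracT mul1e.
apply/eqP; rewrite eq_le; apply/andP; split.
  (* Upper bound: a simple function below [g] is measurable, so its integral is the sum over the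
     atoms, which is at most that of [g]. *)
  rewrite ge0_integralTE//; apply: ge_ereal_sup => _ [h hg <-].
  rewrite -integralT_nnsfun measurable_case; last 2 first.
    exact/measurable_EFinP.
    by move=> x; rewrite lee_fin.
  apply: lee_nneseries => [k _ _|k _]; first by rewrite mule_ge0// lee_fin.
  by rewrite lee_pmul// lee_fin.
(* Lower bound: [w] lies below [g], agrees with it at the atoms, and is measurable because it
   vanishes off a countable set. *)
pose w x := if x \in range u then g x else 0%E.
have w0 x : (0 <= w x)%E by rewrite /w; case: ifP.
have mw : measurable_fun [set: T] w.
  have cU (Y : set T) : Y `<=` range u -> measurable Y.
    move=> YU; apply: countable_measurable => //.
    by apply: sub_countable (subset_card_le YU) _; exact: card_image_le.
  (* The preimage of [Y] is co-countable or countable according to whether [Y] contains the default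
     value 0. *)
  move=> _ Y mY; rewrite setTI; have [Y0|Y0] := pselect (Y 0%E).
    rewrite -[_ @^-1` _]setCK; apply/measurableC/cU => x /=.
    by rewrite /w; case: ifPn => //; rewrite inE.
  by apply: cU => x /=; rewrite /w; case: ifPn => //; rewrite inE.
rewrite (_ : (\sum_(k <oo) _ = \int[mu]_x w x)%E); last first.
  rewrite measurable_case//; apply: eq_eseriesr => k _.
  by rewrite /w mem_set//; exists k.
rewrite !ge0_integralTE//; apply: ereal_sup_le => _ [h hw <-]; exists h => // x.
by apply: le_trans (hw x) _; rewrite /w; case: ifP.
Qed.

Lemma measurable_set1_rV (R : realType) n (x : 'rV[R]_n) : measurable [set x].
Proof.
rewrite (_ : [set x] = [set y | forall i, [set x ord0 i] (y ord0 i)]).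
  by apply: (measurable_box (B := fun i => [set x ord0 i])) => i; exact: measurable_set1.
by apply/seteqP; split => [y ->//|y /= xy]; apply/rowP.
Qed.

(** * Simultaneous recurrence of finitely many rotations *)

(** Cut [[-1, 1]] into cells of width [1 / L < e]. Among more times than there are assignments of
    cells to the indices, two must share all their cells. *)
Lemma pigeonhole_close (R : realType) (I : finType) (w : nat -> I -> R) (e : R) :
  0 < e -> (forall n i, `|w n i| <= 1) ->
  exists p q : nat, (p < q)%N /\ forall i, `|w q i - w p i| < e.
Proof.
move=> e0 w1; pose L := (Num.truncn e^-1).+1.
have L0 : 0 < L%:R :> R by rewrite ltr0n.
have Le : L%:R^-1 < e by rewrite invf_plt ?posrE// truncnS_gt.
have c0 n i : 0 <= (w n i + 1) * L%:R.
  by rewrite mulr_ge0 ?ler0n//; have := w1 n i; rewrite ler_norml => /andP[]; lra.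
(* The value 1 falls in a cell of its own, numbered [2 * L], whence [2 * L + 1] cells. *)
have cL n i : (Num.truncn ((w n i + 1) * L%:R) < (2 * L).+1)%N.
  rewrite ltnS -(ler_nat R); apply: (@le_trans _ _ ((w n i + 1) * L%:R)).
    by rewrite truncn_le.
  rewrite natrM ler_pM2r//.
  by have := w1 n i; rewrite ler_norml => /andP[]; lra.
pose b (n : 'I_(#|{ffun I -> 'I_(2 * L).+1}|.+1)) := [ffun i => Ordinal (cL n i)].
have /injectivePn[p [q pq bpq]] : ~~ injectiveb b.
  apply/injectiveP => /leq_card; rewrite card_ord ltnn; exact/negP.
(* Equal truncations put the values scaled by [L] at distance less than 1. Stated for both orders of
   the two times, as the pigeonhole does not say which comes first. *)
have close (p' q' : 'I_(#|{ffun I -> 'I_(2 * L).+1}|.+1)) : b p' = b q' ->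
    forall i, `|w q' i - w p' i| < e.
  move=> /ffunP bE i; have := bE i; rewrite !ffunE => -[tE].
  apply: lt_trans Le; rewrite -[ltRHS]mul1r ltr_pdivlMr//.
  rewrite -[X in _ * X]gtr0_norm// -normrM.
  have := truncn_itv (c0 p' i); rewrite tE => /andP[p1 p2].
  have := truncn_itv (c0 q' i) => /andP[q1 q2].
  rewrite -natr1 in p2 q2.
  by rewrite ltr_norml; apply/andP; split; lra.
move: pq; rewrite -(inj_eq val_inj) neq_ltn => /orP[pq|qp].
  by exists p, q; split => //; exact: close.
by exists q, p; split => //; apply: close.
Qed.

(* [2 - 2 * cos (n * t)] is the squared distance from [expi (n * t)] to [1], hence
   from [expi (q * t)] to [expi (p * t)] when [n = q - p]: pigeonhole on the pairs
   (cos, sin) needs no arithmetic modulo [2 * pi]. *)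
Lemma recurrence_circle (R : realType) (I : finType) (t : I -> R) (N : nat) (e : R) :
  0 < e -> (0 < N)%N -> exists2 n : nat, (N <= n)%N &
    forall i, 2 - 2 * cos (n%:R * t i) <= e.
Proof.
move=> e0 N0.
(* Only multiples of [N] are sampled, so that the difference of two distinct times is at least
   [N]. *)
pose w (n : nat) (j : I * bool) : R :=
  if j.2 then cos ((n * N)%:R * t j.1) else sin ((n * N)%:R * t j.1).
(* With [d <= 1], a number of modulus below [d] has square at most [d]; the cosine and sine parts
   then contribute at most [e / 2] each. *)
pose d := Num.min 1 (e / 2).
have d0 : 0 < d by rewrite lt_min ltr01 divr_gt0.
have [|p [q [pq close]]] := pigeonhole_close (w := w) d0.
  move=> n [i []] /=; rewrite /w /= ler_norml; first by rewrite cos_geN1 cos_le1.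
  by rewrite sin_geN1 sin_le1.
exists ((q - p) * N)%N; first by rewrite leq_pmull// subn_gt0.
move=> i; have := close (i, true); have := close (i, false).
rewrite /w /=.
have -> : ((q - p) * N)%:R * t i = (q * N)%:R * t i - (p * N)%:R * t i.
  by rewrite mulnBl natrB ?leq_mul2r ?(ltnW pq) ?orbT// mulrBl.
rewrite cosB.
have := cos2Dsin2 ((q * N)%:R * t i); have := cos2Dsin2 ((p * N)%:R * t i).
set cq := cos ((q * N)%:R * _); set cp := cos _; set sq := sin ((q * N)%:R * _).
set sp := sin _ => P Q s c.
have sqd (z : R) : `|z| < d -> z ^+ 2 <= d.
  move=> zd; rewrite -real_normK ?num_real// expr2 -[leRHS]mul1r.
  apply: ler_pM => //; apply: ltW => //; apply: lt_le_trans zd _.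
  by rewrite ge_min lexx.
have dE : d <= e / 2 by rewrite ge_min lexx orbT.
by have := sqd _ s; have := sqd _ c; lra.
Qed.

(** * Real part, imaginary part and modulus *)

Section complex_numbers.
Context {R : rcfType}.
Implicit Types z w : R[i].

Lemma Re_complexB z w : complex.Re (z - w) = complex.Re z - complex.Re w.
Proof. by case: z w => [? ?] [? ?]. Qed.

Lemma Im_complexB z w : complex.Im (z - w) = complex.Im z - complex.Im w.
Proof. by case: z w => [? ?] [? ?]. Qed.

Lemma Re_complexM z w :
  complex.Re (z * w) = complex.Re z * complex.Re w - complex.Im z * complex.Im w.
Proof. by case: z w => [? ?] [? ?]. Qed.

Lemma Im_complexM z w :
  complex.Im (z * w) = complex.Re z * complex.Im w + complex.Im z * complex.Re w.
Proof. by case: z w => [? ?] [? ?]. Qed.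

Lemma sqr_normc z : normc z ^+ 2 = complex.Re z ^+ 2 + complex.Im z ^+ 2.
Proof. by case: z => a b /=; rewrite sqr_sqrtr// addr_ge0// sqr_ge0. Qed.

Lemma normc_ge0 z : 0 <= normc z.
Proof. by case: z => a b /=; exact: sqrtr_ge0. Qed.

Lemma ler_norm_Re z : `|complex.Re z| <= normc z.
Proof.
by case: z => a b /=; rewrite -sqrtr_sqr ler_wsqrtr// lerDl sqr_ge0.
Qed.

Lemma ler_norm_Im z : `|complex.Im z| <= normc z.
Proof.
by case: z => a b /=; rewrite -sqrtr_sqr ler_wsqrtr// lerDr sqr_ge0.
Qed.

Lemma ler_normc z : normc z <= `|complex.Re z| + `|complex.Im z|.
Proof.
rewrite -(@ler_pXn2r _ 2)// ?nnegrE ?normc_ge0 ?addr_ge0//.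
rewrite sqr_normc sqrrD !real_normK ?num_real//.
by rewrite addrAC lerDl mulrn_wge0// mulr_ge0.
Qed.

End complex_numbers.

(** * Integrals of complex-valued functions *)

Section complex_integral.
Context {d} {T : measurableType d} {R : realType}.
Implicit Types (mu : {measure set T -> \bar R}) (f g : T -> R[i]).

Definition cintegrable mu f :=
  mu.-integrable setT (EFin \o (@complex.Re R \o f)) /\
  mu.-integrable setT (EFin \o (@complex.Im R \o f)).

Lemma cmeasurable_cst (c : R[i]) : cmeasurable_fun (fun _ : T => c).
Proof. by split; exact: measurable_cst. Qed.

Lemma cmeasurableB f g : cmeasurable_fun f -> cmeasurable_fun g ->
  cmeasurable_fun (fun x => f x - g x).
Proof.
move=> [fr fi] [gr gi]; split.
  rewrite (_ : _ \o _ = (@complex.Re R \o f) \- (@complex.Re R \o g)).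
    exact: measurable_funB.
  by apply/funext => x /=; rewrite Re_complexB.
rewrite (_ : _ \o _ = (@complex.Im R \o f) \- (@complex.Im R \o g)).
  exact: measurable_funB.
by apply/funext => x /=; rewrite Im_complexB.
Qed.

Lemma cmeasurableM f g : cmeasurable_fun f -> cmeasurable_fun g ->
  cmeasurable_fun (fun x => f x * g x).
Proof.
move=> [fr fi] [gr gi]; split.
  rewrite (_ : _ \o _ = (@complex.Re R \o f) \* (@complex.Re R \o g) \-
                        (@complex.Im R \o f) \* (@complex.Im R \o g)).
    by apply: measurable_funB; exact: measurable_funM.
  by apply/funext => x /=; rewrite Re_complexM.
rewrite (_ : _ \o _ = (@complex.Re R \o f) \* (@complex.Im R \o g) \+
                      (@complex.Im R \o f) \* (@complex.Re R \o g)).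
  by apply: measurable_funD; exact: measurable_funM.
by apply/funext => x /=; rewrite Im_complexM.
Qed.

Lemma measurable_sqr_normc f : cmeasurable_fun f ->
  measurable_fun [set: T] (fun x => normc (f x) ^+ 2).
Proof.
move=> [fr fi]; under eq_fun do rewrite sqr_normc.
by apply: measurable_funD; exact: measurable_funX.
Qed.

Lemma cintegralB mu f g : cintegrable mu f -> cintegrable mu g ->
  cintegral mu (fun x => f x - g x) = cintegral mu f - cintegral mu g.
Proof.
move=> [fr fi] [gr gi]; rewrite /cintegral.
rewrite (_ : _ \o _ = (@complex.Re R \o f) \- (@complex.Re R \o g)); last first.
  by apply/funext => x /=; rewrite Re_complexB.
rewrite (_ : @complex.Im R \o (fun x => f x - g x) =
             (@complex.Im R \o f) \- (@complex.Im R \o g)); last first.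
  by apply/funext => x /=; rewrite Im_complexB.
by rewrite !RintegralB.
Qed.

Lemma cintegralZ mu f (c : R[i]) : cintegrable mu f ->
  cintegral mu (fun x => c * f x) = c * cintegral mu f.
Proof.
move=> [fr fi]; rewrite /cintegral; case: c => a b.
have ZI (k : R) (h : T -> R) : mu.-integrable setT (EFin \o h) ->
    mu.-integrable setT (EFin \o (fun x => k * h x)).
  by move=> hi; apply: eq_integrable (integrableZl measurableT k hi).
rewrite (_ : _ \o _ = fun x => a * complex.Re (f x) - b * complex.Im (f x));
  last by apply/funext => x /=; rewrite Re_complexM.
rewrite (_ : @complex.Im R \o _ =
    fun x => a * complex.Im (f x) + b * complex.Re (f x));
  last by apply/funext => x /=; rewrite Im_complexM.
rewrite RintegralB ?RintegralD ?RintegralZl//; exact: ZI.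
Qed.

Lemma ae_eq_cintegral mu f g : cmeasurable_fun f -> cmeasurable_fun g ->
  {ae mu, forall x, f x = g x} -> cintegral mu f = cintegral mu g.
Proof.
move=> [fr fi] [gr gi] fg; rewrite /cintegral /Rintegral; congr (fine _ +i* fine _).
  apply: ae_eq_integral => //; [exact/measurable_EFinP..|].
  by apply: filterS fg => x /= -> _.
apply: ae_eq_integral => //; [exact/measurable_EFinP..|].
by apply: filterS fg => x /= -> _.
Qed.

Lemma ae_eq_L2norm2 mu f g : cmeasurable_fun f -> cmeasurable_fun g ->
  {ae mu, forall x, f x = g x} -> L2norm2 mu f = L2norm2 mu g.
Proof.
move=> mf mg fg; apply: ae_eq_integral => //.
- by apply/measurable_EFinP; exact: measurable_sqr_normc.
- by apply/measurable_EFinP; exact: measurable_sqr_normc.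
- by apply: filterS fg => x /= -> _.
Qed.

Lemma cintegrable_bounded_support mu f (D : set T) (C : R) :
  cmeasurable_fun f -> measurable D -> (mu D < +oo)%E ->
  (forall x, normc (f x) <= C) -> (forall x, ~ D x -> f x = 0) ->
  cintegrable mu f.
Proof.
move=> [fr fi] mD muD fC f0.
have integrable_part (h : T -> R) : measurable_fun [set: T] h ->
    (forall x, `|h x| <= C) -> (forall x, ~ D x -> h x = 0) ->
    mu.-integrable setT (EFin \o h).
  move=> mh hC h0; rewrite (_ : EFin \o h = (EFin \o h) \_ D); last first.
    by apply/funext => x; rewrite patchE; case: ifPn => //;
      rewrite notin_setE => /h0 /= ->.
  apply/(integrable_mkcond _ mD)/measurable_bounded_integrable => //.
    exact: measurable_funTS.
  exists C; split; first exact: num_real.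
  by move=> y Cy x _; exact: le_trans (hC x) (ltW Cy).
split; apply: integrable_part => //.
- by move=> x; exact: le_trans (ler_norm_Re _) (fC x).
- by move=> x /f0 /= ->.
- by move=> x; exact: le_trans (ler_norm_Im _) (fC x).
- by move=> x /f0 /= ->.
Qed.

(** The pushforward of [mu] under [s] agrees with [mu], which settles nonnegative functions;
    positive and negative parts commute with composition. *)
Lemma integral_measure_preserving mu (s : T -> T) (h : T -> \bar R) :
  measurable_fun [set: T] s ->
  (forall A, measurable A -> mu (s @^-1` A) = mu A) ->
  measurable_fun [set: T] h -> (\int[mu]_x h (s x) = \int[mu]_x h x)%E.
Proof.
move=> ms mus mh.
have ge0_case (k : T -> \bar R) : measurable_fun [set: T] k ->
    (forall x, 0 <= k x)%E -> (\int[mu]_x k (s x) = \int[mu]_x k x)%E.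
  move=> mk k0; transitivity (\int[pushforward mu s]_x k x)%E.
    by rewrite ge0_integral_pushforward ?preimage_setT//.
  by apply: eq_measure_integral => A mA _; exact: mus.
rewrite integralE [RHS]integralE; congr (_ - _)%E.
  under eq_integral do rewrite (funepos_comp h s).
  by apply: ge0_case => //; exact: measurable_funepos.
under eq_integral do rewrite (funeneg_comp h s).
by apply: ge0_case => //; exact: measurable_funeneg.
Qed.

Lemma cintegral_measure_preserving mu (s : T -> T) f :
  measurable_fun [set: T] s ->
  (forall A, measurable A -> mu (s @^-1` A) = mu A) ->
  cmeasurable_fun f -> cintegral mu (f \o s) = cintegral mu f.
Proof.
move=> ms mus [fr fi]; rewrite /cintegral /Rintegral; congr (fine _ +i* fine _).
  apply: (integral_measure_preserving (h := EFin \o (@complex.Re R \o f))) => //.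
  exact/measurable_EFinP.
apply: (integral_measure_preserving (h := EFin \o (@complex.Im R \o f))) => //.
exact/measurable_EFinP.
Qed.

(** The chosen Hahn decomposition depends on [nu] alone, so all three integrals use the same two
    Jordan parts. These are finite measures, for which bounded measurable functions are
    integrable. *)
Lemma charge_integralB (nu : {charge set T -> \bar R}) f g (C : R) :
  cmeasurable_fun f -> cmeasurable_fun g ->
  (forall x, normc (f x) <= C) -> (forall x, normc (g x) <= C) ->
  charge_integral nu (fun x => f x - g x) =
  charge_integral nu f - charge_integral nu g.
Proof.
move=> mf mg fC gC; rewrite /charge_integral.
case: cid => A exB; case: cid => B AB.
have bounded_cintegrable (m : {finite_measure set T -> \bar R}) (h : T -> R[i]) :
    cmeasurable_fun h -> (forall x, normc (h x) <= C) -> cintegrable m h.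
  move=> mh hC; apply: (cintegrable_bounded_support (D := setT) mh _ _ hC) => //.
    by rewrite ltey_eq fin_num_measure.
  by move=> x /(_ I).
have subE (m1 m2 : {finite_measure set T -> \bar R}) :
    cintegral m1 (fun x => f x - g x) - cintegral m2 (fun x => f x - g x) =
    cintegral m1 f - cintegral m2 f - (cintegral m1 g - cintegral m2 g).
  by rewrite !cintegralB; [ring|exact: bounded_cintegrable..].
exact: (subE (jordan_pos AB) (jordan_neg AB)).
Qed.

End complex_integral.

(** * Square integrable complex random variables *)

Section complex_random_variables.
Context {d} {T : measurableType d} {R : realType} (P : probability T R).
Implicit Types X Y Z : T -> R[i].

(** Both parts of [X] are dominated by [1 + |X|^2], which is integrable under a probability. *)
Lemma csquare_integrable_cintegrable X :
  csquare_integrable P X -> cintegrable P X.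
Proof.
move=> [mX X2]; pose g x := 1 + normc (X x) ^+ 2.
have gi : P.-integrable setT (EFin \o g).
  rewrite (_ : EFin \o g = (cst 1%:E \+ (fun x => (normc (X x) ^+ 2)%:E))%E);
    last by apply/funext.
  apply: integrableD => //; first exact: finite_measure_integrable_cst.
  apply/integrableP; split.
    by apply/measurable_EFinP; exact: measurable_sqr_normc.
  by under eq_integral do rewrite gee0_abs ?lee_fin ?sqr_ge0//.
have le_g (a : R) x : `|a| <= normc (X x) -> `|a| <= `|g x|.
  move=> aX; apply: (le_trans aX); apply: le_trans (ler_norm _); rewrite /g.
  (* The square gives [|X| <= |X|^2 + 1/4]. *)
  by have := sqr_ge0 (normc (X x) - 1 / 2); lra.
split; apply: le_integrable gi => //.
- by apply/measurable_EFinP; case: mX.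
- by move=> x _ /=; rewrite lee_fin le_g// ler_norm_Re.
- by apply/measurable_EFinP; case: mX.
- by move=> x _ /=; rewrite lee_fin le_g// ler_norm_Im.
Qed.

(** Uses [|z - c|^2 <= 2 |z|^2 + 2 |c|^2], where the two sides differ by [|z + c|^2]. *)
Lemma cvariance_lty X : csquare_integrable P X -> (cvariance P X < +oo)%E.
Proof.
move=> [mX X2]; set c := cintegral P X; rewrite /cvariance -/c.
pose C := 2 * normc c ^+ 2.
have mX2 := measurable_sqr_normc mX.
apply: (@le_lt_trans _ _
    (\int[P]_x ((2%:E * (normc (X x) ^+ 2)%:E) + C%:E)%E)%E).
  apply: ge0_le_integral => //.
  - by move=> x _; rewrite lee_fin sqr_ge0.
  - apply/measurable_EFinP/measurable_sqr_normc/cmeasurableB => //.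
    exact: cmeasurable_cst.
  - apply: emeasurable_funD => //; apply: measurable_funeM.
    exact/measurable_EFinP.
  - move=> x _; rewrite -EFinM -EFinD lee_fin /C !sqr_normc.
    rewrite Re_complexB Im_complexB.
    have := sqr_ge0 (complex.Re (X x) + complex.Re c).
    by have := sqr_ge0 (complex.Im (X x) + complex.Im c); nra.
have C0 : 0 <= C by rewrite mulr_ge0// sqr_ge0.
have mZ : measurable_fun [set: T] (fun x => (2%:E * (normc (X x) ^+ 2)%:E)%E).
  by apply: measurable_funeM; exact/measurable_EFinP.
have Z0 x : [set: T] x -> (0 <= 2%:E * (normc (X x) ^+ 2)%:E)%E.
  by rewrite mule_ge0// lee_fin// sqr_ge0.
have n0 x : [set: T] x -> (0 <= (normc (X x) ^+ 2)%:E)%E.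
  by rewrite lee_fin sqr_ge0.
rewrite ge0_integralD// ge0_integralZl//; last exact/measurable_EFinP.
rewrite lte_add_pinfty// ?lte_mul_pinfty//.
by rewrite integral_cst// lte_mul_pinfty// ltey_eq fin_num_measure.
Qed.

Lemma cvariance_ae_diff X Y Z :
  csquare_integrable P X -> csquare_integrable P Y -> csquare_integrable P Z ->
  {ae P, forall w, Z w = X w - Y w} ->
  L2norm2 P (fun w => (X w - cintegral P X) - (Y w - cintegral P Y)) =
  cvariance P Z.
Proof.
move=> sX sY sZ ZXY.
have [[[mX _] [mY _]] [mZ _]] := (sX, sY, sZ).
have EZ : cintegral P Z = cintegral P X - cintegral P Y.
  rewrite -cintegralB; [|exact: csquare_integrable_cintegrable..].
  by apply: ae_eq_cintegral => //; exact: cmeasurableB.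
have mc (c : R[i]) : cmeasurable_fun (fun _ : T => c) := cmeasurable_cst c.
rewrite /cvariance; apply: ae_eq_L2norm2.
- by apply: cmeasurableB; exact: cmeasurableB.
- exact: cmeasurableB.
- by apply: filterS ZXY => w ->; rewrite EZ; ring.
Qed.

End complex_random_variables.

(** * Fourier transforms of bounded functions with bounded support *)

Section fourier_transform.
Context {R : realType} {d : nat}.
Local Notation V := 'rV[R]_d.
Implicit Types (f g : V -> R[i]) (u v x : V).

(** The kernel [exp (- i u.x)] of [fourier]. *)
Definition character u x : R[i] := cos (dotp u x) -i* sin (dotp u x).

(** For [r >= 0], the closed ball of the sup norm. Being compact and of finite Lebesgue measure, it
    serves both for integrability and as a set on which the random measure induces complex
    measures. *)
Definition cube (r : R) : set V := [set x | forall i, `[-r, r]%classic (x ord0 i)].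

Lemma ler_norm_coord x (i : 'I_d) : `|x ord0 i| <= `|x|.
Proof.
by rewrite [leRHS]/Num.norm /= mx_normrE; apply/bigmax_geP; right; exists (ord0, i).
Qed.

Lemma subset_cube x r : `|x| <= r -> cube r x.
Proof.
by move=> xr i /=; rewrite in_itv /= -ler_norml (le_trans (ler_norm_coord x i)).
Qed.

Lemma measurable_cube r : measurable (cube r).
Proof.
by apply: (measurable_box (B := fun=> `[-r, r]%classic)) => i; exact: measurable_itv.
Qed.

Lemma lebesgue_cube_lty r : (lebesgue_rV d (cube r) < +oo)%E.
Proof.
rewrite (lebesgue_rV_box (B := fun=> `[-r, r]%classic)); last first.
  by move=> i; exact: measurable_itv.
rewrite ltey_eq; apply/orP; left.
elim/big_ind : _ => // [a b|i _]; first exact: fin_numM.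
by rewrite lebesgue_measure_itv /=; case: ifP.
Qed.

Lemma compact_cube r : compact (cube r).
Proof.
by apply: (@rV_compact _ _ (fun=> `[-r, r]%classic)) => i; exact: segment_compact.
Qed.

Lemma Ccb_support B f : Ccb B f ->
  exists2 r : R, 0 < r & forall x, f x != 0 -> `|x| <= r.
Proof.
(* [bounded_set] provides a bound for each radius strictly above [r]; this one is also positive. *)
move=> [_ _ [r [_ fr]] _]; exists (`|r| + 1); first by rewrite ltr_wpDl.
by move=> x; apply: fr; rewrite (le_lt_trans (ler_norm r))// ltrDl.
Qed.

Lemma sub_Ccb B B' f : B `<=` B' -> Ccb B f -> Ccb B' f.
Proof.
by move=> BB' [mf bf sf f0]; split => // x B'x; apply: f0 => /BB'.
Qed.

Lemma CcbT_sub B f : (forall x, f x != 0 -> B x) -> Ccb setT f -> Ccb B f.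
Proof.
move=> fB [mf bf sf _]; split => // x; apply: contra_notP => /eqP; exact: fB.
Qed.

Lemma CcbB B f g : Ccb B f -> Ccb B g -> Ccb B (fun x => f x - g x).
Proof.
move=> fB gB; have [r r0 fr] := Ccb_support fB; have [s s0 gs] := Ccb_support gB.
case: fB gB => [mf [C fC] _ f0] [mg [D gD] _ g0].
split; first exact: cmeasurableB.
(* One [C + D] for the real part and one for the imaginary part. *)
- exists ((C + D) + (C + D)) => x; apply: le_trans (ler_normc _) _.
  rewrite Re_complexB Im_complexB; apply: lerD; apply: le_trans (ler_normB _ _) _.
    by apply: lerD; [exact: le_trans (ler_norm_Re _) (fC x)|
                     exact: le_trans (ler_norm_Re _) (gD x)].
  by apply: lerD; [exact: le_trans (ler_norm_Im _) (fC x)|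
                   exact: le_trans (ler_norm_Im _) (gD x)].
- exists (r + s); split; first exact: num_real.
  move=> t rst x /= fgx; apply: le_trans (ltW rst).
  have [fx0|/fr xr] := eqVneq (f x) 0.
    have /gs xs : g x != 0 by apply: contraNneq fgx => ->; rewrite fx0 subr0.
    by rewrite (le_trans xs)// lerDr ltW.
  by rewrite (le_trans xr)// lerDl ltW.
- by move=> x Bx; rewrite f0// g0// subr0.
Qed.

Lemma Ccb_translate f x : Ccb setT f -> Ccb setT (translate x f).
Proof.
move=> fT; have [r r0 fr] := Ccb_support fT; case: fT => [[mr mi] [C fC] _ _].
split.
- have ms := measurable_shift_rV x.
  by split; [exact: (measurableT_comp mr ms)|exact: (measurableT_comp mi ms)].
- by exists C => y; exact: fC.
- exists (r + `|x|); split; first exact: num_real.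
  move=> t rxt y /= /fr yr; apply: le_trans (ltW rxt).
  by rewrite -[y](subrK x) (le_trans (ler_normD _ _))// lerD2r.
- by move=> y /(_ I).
Qed.

Lemma dotpB u x v : dotp u (x - v) = dotp u x - dotp u v.
Proof. by rewrite /dotp -sumrB; apply: eq_bigr => i _; rewrite !mxE mulrBr. Qed.

Lemma dotpZ u (a : R) v : dotp u (a *: v) = a * dotp u v.
Proof. by rewrite /dotp mulr_sumr; apply: eq_bigr => i _; rewrite !mxE mulrCA. Qed.

Lemma measurable_dotp u : measurable_fun [set: V] (dotp u).
Proof.
apply: measurable_sum => i; apply: measurable_funM; first exact: measurable_cst.
exact: measurable_coord.
Qed.

Lemma cmeasurable_character u : cmeasurable_fun (character u).
Proof.
have md := measurable_dotp u; split.
  by apply: (measurableT_comp (f := @cos R)) => //;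
    apply: continuous_measurable_fun; exact: continuous_cos.
apply: measurable_funN; apply: (measurableT_comp (f := @sin R)) => //.
by apply: continuous_measurable_fun; exact: continuous_sin.
Qed.

Lemma normc_character u x : normc (character u x) = 1.
Proof. by rewrite /character /normc sqrrN cos2Dsin2 sqrtr1. Qed.

Lemma cintegrable_fourier u f : Ccb setT f ->
  cintegrable (lebesgue_rV d) (fun x => character u x * f x).
Proof.
move=> fT; have [r r0 fr] := Ccb_support fT; case: fT => [mf [C fC] _ _].
apply: (cintegrable_bounded_support (D := cube r) (C := C)).
- by apply: cmeasurableM => //; exact: cmeasurable_character.
- exact: measurable_cube.
- exact: lebesgue_cube_lty.
- by move=> x; rewrite normcM normc_character mul1r.
- move=> x Dx; have [->|/fr/subset_cube//] := eqVneq (f x) 0.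
  by rewrite mulr0.
Qed.

Lemma fourierB f g u : Ccb setT f -> Ccb setT g ->
  fourier (fun x => f x - g x) u = fourier f u - fourier g u.
Proof.
move=> fT gT; rewrite /fourier -cintegralB; [|exact: cintegrable_fourier..].
by congr cintegral; apply/funext => x; rewrite mulrBr.
Qed.

(** Change of variables [y - x] in the integral, together with multiplicativity of the character. *)
Lemma fourier_translate f x u : Ccb setT f ->
  fourier (translate x f) u =
  character u x * fourier f u.
Proof.
move=> fT; rewrite /fourier -cintegralZ; last exact: cintegrable_fourier.
rewrite -[RHS](cintegral_measure_preserving (s := fun y : V => y - x)).
- congr cintegral; apply/funext => y /=; rewrite /translate mulrA; congr (_ * _).
  (* Expanding the angle [u.y - u.x] leaves the wanted character times [cos^2 + sin^2] of [u.x]. *)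
  rewrite /character dotpB cosB sinB; apply/eqP; rewrite eq_complex /=.
  have := cos2Dsin2 (dotp u x).
  set a := cos (dotp u x); set b := sin (dotp u x).
  set a' := cos (dotp u y); set b' := sin (dotp u y) => ab1.
  apply/andP; split; apply/eqP.
    transitivity (a' * (a ^+ 2 + b ^+ 2)); first by rewrite ab1 mulr1.
    by ring.
  transitivity (- b' * (a ^+ 2 + b ^+ 2)); first by rewrite ab1 mulr1.
  by ring.
- exact: measurable_shift_rV.
- by move=> A; exact: lebesgue_rV_shift.
- apply: cmeasurableM; first exact: cmeasurable_cst.
  apply: cmeasurableM; first exact: cmeasurable_character.
  by case: fT.
Qed.

(** The first factor is [|exp (- i u.x) - 1|^2]. *)
Lemma sqr_normc_fourier_increment f x u : Ccb setT f ->
  normc (fourier (fun y => translate x f y - f y) u) ^+ 2 =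
  (2 - 2 * cos (dotp u x)) * normc (fourier f u) ^+ 2.
Proof.
move=> fT; rewrite fourierB//; last exact: Ccb_translate.
rewrite fourier_translate// -[X in _ - X]mul1r -mulrBl normcM exprMn.
congr (_ * _); rewrite sqr_normc Re_complexB Im_complexB /= subr0.
by have := cos2Dsin2 (dotp u x); lra.
Qed.

End fourier_transform.

(** * Variance of the increments of the random measure *)

Section random_measure.
Context {R : realType} {d : nat} {dO : measure_display}.
Context {Omega : measurableType dO} (P : probability Omega R).
Local Notation V := 'rV[R]_d.
Context (M : (V -> R[i]) -> Omega -> R[i]).
Context (wM : weakly_stationary_random_measure P M).
Implicit Types (f g : V -> R[i]) (v : V).

(** Additivity comes from the induced complex measures: almost surely, on one cube that contains
    both supports, [M] is integration against two charges. *)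
Lemma random_measureB_ae f g : Ccb setT f -> Ccb setT g ->
  {ae P, forall w, M (fun x => f x - g x) w = M f w - M g w}.
Proof.
move=> fT gT; have [r r0 fr] := Ccb_support fT; have [s s0 gs] := Ccb_support gT.
have cubeW (h : V -> R[i]) t : Ccb setT h -> (forall x, h x != 0 -> `|x| <= t) ->
    t <= r + s -> Ccb (cube (r + s)) h.
  move=> hT ht trs; apply: CcbT_sub hT => x /ht xt.
  by apply: subset_cube; exact: le_trans trs.
have fK : Ccb (cube (r + s)) f by apply: (cubeW _ r) => //; lra.
have gK : Ccb (cube (r + s)) g by apply: (cubeW _ s) => //; lra.
have [_ Mm _] := wM; apply: filterS Mm => w /(_ _ (@compact_cube R d (r + s))).
move=> [nr [ni mE]]; rewrite (mE _ (CcbB fK gK)) (mE _ fK) (mE _ gK).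
case: fT gT => [mf [C fC] _ _] [mg [D gD] _ _].
have subE nu : charge_integral nu (fun x => f x - g x) =
    charge_integral nu f - charge_integral nu g.
  apply: (@charge_integralB _ V R nu f g (Num.max C D)) => // x; rewrite le_max.
    by rewrite fC.
  by rewrite gD orbT.
by rewrite !subE; ring.
Qed.

(** Turns the [L^2] distance to be made small into a variance, which the spectral measure
    computes. *)
Lemma L2norm2_centeredB f g : Ccb setT f -> Ccb setT g ->
  L2norm2 P (fun w => centered P M f w - centered P M g w) =
  cvariance P (M (fun x => f x - g x)).
Proof.
move=> fT gT; have [M2 _ _] := wM; apply: cvariance_ae_diff.
- exact: M2.
- exact: M2.
- by apply: M2; exact: CcbB.
- exact: random_measureB_ae.
Qed.

(** The variance is [c] times the sum of [q k * b k], where [q k] is the factor due to the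
    translation and [b k] the contribution of the atom [u k] to the variance of [M f]. The [b k] are
    summable and [q k <= 4]; recurrence makes [q k] small for [k < m]. *)
Lemma cvariance_increment_small (S : {measure set V -> \bar R}) f v (N : nat) (e : R) :
  is_spectral_measure P M S -> purely_atomic S -> Ccb setT f ->
  (0 < N)%N -> 0 < e ->
  exists2 n : nat, (N <= n)%N &
    (cvariance P (M (fun y => translate (n%:R *: v) f y - f y)%R) <= e%:E)%E.
Proof.
move=> [_ spec _] [a [u Sau]] fT N0 e0.
have [M2 _ _] := wM.
set c : R := (2 * pi) ^- d.
have c0 : 0 < c by rewrite invr_gt0 exprn_gt0// mulr_gt0// pi_gt0.
have varE g : Ccb setT g -> (cvariance P (M g) = c%:E *
    \sum_(k <oo) ((a k)%:num * normc (fourier g (u k)) ^+ 2)%:E)%E.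
  move=> gT; rewrite spec// /L2norm2; congr (_ * _)%E.
  rewrite (integral_atomic (measurable_set1_rV (n := d)) Sau)//.
  by move=> x; rewrite lee_fin sqr_ge0.
pose b k : R := (a k)%:num * normc (fourier f (u k)) ^+ 2.
have b0 k : 0 <= b k by rewrite mulr_ge0// sqr_ge0.
have be0 k : (0 <= (b k)%:E)%E by rewrite lee_fin.
(* An infinite sum would make the variance of [M f] infinite, since [c] is positive. *)
have sb : (\sum_(k <oo) (b k)%:E < +oo)%E.
  have := cvariance_lty (M2 _ fT); rewrite varE//.
  rewrite !ltey; apply: contra => /eqP ->.
  by rewrite gt0_muley// lte_fin.
(* The bound [4] on [q k] will turn this into [e / c / 2]. *)
have [m tail_m] : exists m,
    (\sum_(m <= k <oo) (b k)%:E <= (e / c / 8)%:E)%E.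
  have /= := nneseries_tail_cvg sb (fun k _ => be0 k).
  have h0 : 0 < e / c / 8 by rewrite !divr_gt0.
  move=> /fine_cvgP[fin_tail /cvgr0_norm_le /(_ _ h0) small_tail].
  (* At a common index the tail is both finite and small, so [fine] can be removed. *)
  have [m _ /(_ m (leqnn m)) [/= fm sm]] := filterI fin_tail small_tail.
  exists m; rewrite -(fineK fm) lee_fin.
  by apply: le_trans sm; exact: ler_norm.
set B := (\sum_(k <oo) (b k)%:E)%E in sb.
have B0 : (0 <= B)%E by exact: nneseries_ge0.
have Bfin : B \is a fin_num by rewrite ge0_fin_numE.
have fB0 : 0 <= fine B by exact: fine_ge0.
(* Chosen so that [delta * B <= e / c / 2]; the added 1 keeps the denominator positive when [B] is
   zero. *)
pose delta := e / c / 2 / (fine B + 1).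
have delta0 : 0 < delta by rewrite !divr_gt0// ltr_wpDl.
have [n Nn close] := recurrence_circle (fun i : 'I_m => dotp (u i) v) delta0 N0.
exists n => //.
pose q k : R := 2 - 2 * cos (n%:R * dotp (u k) v).
have q0 k : 0 <= q k by rewrite /q; have := cos_le1 (n%:R * dotp (u k) v); lra.
have q4 k : q k <= 4 by rewrite /q; have := cos_geN1 (n%:R * dotp (u k) v); lra.
rewrite varE; last by apply: CcbB => //; exact: Ccb_translate.
rewrite (_ : (\sum_(k <oo) _ = \sum_(k <oo) (q k * b k)%:E)%E); last first.
  apply: eq_eseriesr => k _; rewrite sqr_normc_fourier_increment// dotpZ.
  by rewrite mulrCA.
have qb0 k : (0 <= (q k * b k)%:E)%E by rewrite lee_fin mulr_ge0.
rewrite (nneseries_split 0 m)// add0n.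
(* Here [q k <= delta]; completing the sum of the [b k] to the full series only increases it. *)
have head : (\sum_(0 <= k < m) (q k * b k)%:E <= (e / c / 2)%:E)%E.
  apply: (@le_trans _ _ (delta%:E * B)%E).
    rewrite -nneseriesZl//; apply: le_trans (nneseries_lim_ge m _); last first.
      by move=> k _ _; rewrite mule_ge0// lee_fin ltW.
    rewrite !big_mkord; apply: lee_sum => i _.
    by rewrite -EFinM lee_fin ler_wpM2r//; exact: close.
  rewrite -(fineK Bfin) -EFinM lee_fin /delta mulrAC ler_pdivrMr ?ltr_wpDl//.
  by rewrite ler_wpM2l ?lerDl// !divr_ge0// ltW.
have tail : (\sum_(m <= k <oo) (q k * b k)%:E <= (e / c / 2)%:E)%E.
  apply: (@le_trans _ _ (4%:E * \sum_(m <= k <oo) (b k)%:E)%E).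
    rewrite -nneseriesZl//; apply: lee_nneseries => // k _.
    by rewrite -EFinM lee_fin ler_wpM2r.
  apply: (@le_trans _ _ (4%:E * (e / c / 8)%:E)%E); first by rewrite lee_pmul2l.
  by rewrite -EFinM lee_fin; lra.
apply: (@le_trans _ _ (c%:E * ((e / c / 2)%:E + (e / c / 2)%:E))%E).
  by rewrite lee_pmul2l// leeD.
by rewrite -EFinD -EFinM lee_fin -splitr mulrC divfK// lt0r_neq0.
Qed.

End random_measure.

(** * Translation into the cone, and interpolation *)

(** A point [y] of the translated support satisfies [|y - n v| <= r], so [y / n] is within
    [r / n < rho] of [v] and lies in [A]; scaling back by [n] stays in the cone. *)
Lemma cone_translate_Ccb (R : realType) (d : nat) (A : set 'rV[R]_d) v f :
  is_cone A -> interior A v -> Ccb setT f ->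
  exists2 N : nat, (0 < N)%N &
    forall n, (N <= n)%N -> Ccb A (translate (n%:R *: v) f).
Proof.
move=> coneA /nbhs_ballP[rho /= rho0 vA] fT; have [r r0 fr] := Ccb_support fT.
exists (Num.truncn (r / rho)).+1 => // n Nn.
apply: CcbT_sub; last exact: Ccb_translate.
have n0 : 0 < n%:R :> R by rewrite ltr0n; exact: leq_trans Nn.
move=> y /fr yr.
rewrite -[y](scalerKV (lt0r_neq0 n0)); apply: (coneA _ _ _ n0); apply: vA.
rewrite -ball_normE /= -(ltr_pM2l n0) -[X in X * _]gtr0_norm// -normrZ.
rewrite scalerBr scalerKV ?lt0r_neq0// distrC; apply: (le_lt_trans yr).
rewrite mulrC -ltr_pdivrMl// mulrC.
by apply: lt_le_trans (truncnS_gt _) _; rewrite ler_nat.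
Qed.

Theorem theorem6 (R : realType) (d : nat) (dO : measure_display)
    (Omega : measurableType dO) (P : probability Omega R)
    (M : ('rV[R]_d -> R[i]) -> Omega -> R[i])
    (S : {measure set 'rV[R]_d -> \bar R}) (A : set 'rV[R]_d) :
  weakly_stationary_random_measure P M ->
  is_spectral_measure P M S ->
  purely_atomic S ->
  is_cone A ->
  interior A !=set0 ->
  perfectly_interpolable P (centered P M) A /\
  (stationary_mean P M -> perfectly_interpolable P M A).
Proof.
move=> wM specS atomS coneA [v Av].
(* Both conclusions use the same translates, with a variance of at most [1 / (j + 1)] at stage
   [j]. *)
have approx f : Ccb setT f -> exists x : nat -> 'rV[R]_d,
    (forall j, Ccb A (translate (x j) f)) /\
    (L2norm2 P (fun w => centered P M (translate (x j) f) w - centered P M f w)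
      @[j --> \oo] --> 0%E).
  move=> fT; have [N N0 transA] := cone_translate_Ccb coneA Av fT.
  have /choice[n nP] : forall j : nat, exists n : nat, (N <= n)%N /\
      (cvariance P (M (fun y => translate (n%:R *: v) f y - f y)%R) <=
        (j.+1%:R^-1)%:E)%E.
    move=> j; have e0 : 0 < j.+1%:R^-1 :> R by rewrite invr_gt0.
    have [n Nn small] := cvariance_increment_small wM v specS atomS fT N0 e0.
    by exists n.
  exists (fun j => (n j)%:R *: v); split.
    by move=> j; apply: transA; have [] := nP j.
  apply: (squeeze_cvge (f := cst 0%E) (h := EFin \o @harmonic R)).
  - near=> j; apply/andP; split.
      by apply: integral_ge0 => w _; rewrite lee_fin sqr_ge0.
    rewrite L2norm2_centeredB//; last exact: Ccb_translate.
    by have [_] := nP j.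
  - exact: cvg_cst.
  - by apply: cvg_EFin; [exact: nearW|exact: cvg_harmonic].
split=> [|meanM] f /(sub_Ccb (@subsetT _ _)) fT.
  by have [x [xA cvg_x]] := approx f fT; exists (fun j => translate (x j) f).
have [x [xA cvg_x]] := approx f fT; exists (fun j => translate (x j) f) => //.
(* A translation-invariant mean cancels in the difference, so the centered and uncentered distances
   coincide. *)
apply: cvg_trans cvg_x; apply: near_eq_cvg; apply: nearW => j; apply: eq_integral.
by move=> w _; rewrite /centered meanM// opprB addrA subrK.
Unshelve. all: by end_near. Qed.
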